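(* Let $k\geq 2$ and $n\geq 1$ be integers, let $t_1,\dots,t_k$ be indeterminates, and work in the field $\mathbb{C}(t_1,\dots,t_k)$ of rational functions. Set $t_0=1$ and let $i=\sqrt{-1}$. Let $Q_{k,n}=(q_{rs})_{1\le r,s\le n}$ be the $n\times n$ matrix with $$q_{rs}=\begin{cases} i^{|r-s|}\,\dfrac{t_{r-s+1}}{t_2^{\,r-s}} & \text{if } -1\leq r-s<k,\\[2mm] 0 & \text{otherwise.}\end{cases}$$ (Thus the superdiagonal entries are $i t_2$, the diagonal entries are $t_1$, the subdiagonal entries are $i$, and the entries with $r-s=d$, $2\le d\le k-1$, are $i^{d} t_{d+1}/t_2^{d}$.) Then $$\det(Q_{k,n})=F_{k,n+1}(t).$$
   Context: The generalized Fibonacci polynomials $F_{k,n}(t)$, $t=(t_1,\dots,t_k)$, are defined by $F_{k,n}(t)=0$ for $n<1$, $F_{k,1}(t)=1$, $F_{k,2}(t)=t_1$, and $F_{k,n+1}(t)=t_1F_{k,n}(t)+t_2F_{k,n-1}(t)+\cdots+t_kF_{k,n-k+1}(t)$ for $n\ge 1$. *)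

(* Defs.v *)
From mathcomp Require Import all_boot all_order all_algebra.
From mathcomp Require Import fraction mpoly complex reals.

Set Implicit Arguments.
Unset Strict Implicit.
Unset Printing Implicit Defensive.

Import Order.TTheory GRing.Theory Num.Theory.
Local Open Scope ring_scope.

(* For j = 0, 1, ..., k this is t_j, with t_0 = 1; the indeterminates t_1, ..., t_k
   are 'X_0, ..., 'X_(k-1).  Indices j > k give the junk value 0. *)
Definition gvar (C : comNzRingType) (k j : nat) : {mpoly C[k]} :=
  if j is j'.+1 then oapp (fun i : 'I_k => 'X_i) 0 (insub j') else 1.

(* The list [:: F_n; ...; F_1]; reading it past its end with [nth 0] implements
   F_m = 0 for m < 1. *)
Fixpoint genfib_seq (C : comNzRingType) (k n : nat) : seq {mpoly C[k]} :=
  match n with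
  | 0 => [::]
  | 1 => [:: 1]
  | n'.+1 => let s := genfib_seq C k n' in
             (\sum_(j < k) gvar C k j.+1 * s`_j) :: s
  end.

(* F_{k,n}(t), for n an arbitrary integer; the defining equations are
   [genfib_le0], [genfib1], [genfib2] and [genfibS] below. *)
Definition genfib (C : comNzRingType) (k : nat) (n : int) : {mpoly C[k]} :=
  if n is Posz m then (genfib_seq C k m)`_0 else 0.

Lemma genfib_le0 (C : comNzRingType) (k : nat) (n : int) :
  n < 1 -> genfib C k n = 0.
Proof. by case: n => [[|n]|n]. Qed.

Lemma genfib1 (C : comNzRingType) (k : nat) : genfib C k 1 = 1.
Proof. by []. Qed.

Lemma genfib2 (C : comNzRingType) (k : nat) :
  (0 < k)%N -> genfib C k 2 = gvar C k 1.
Proof.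
case: k => // k _; rewrite /genfib /= big_ord_recl /= mulr1 big1 ?addr0 //.
by move=> i _; rewrite nth_nil mulr0.
Qed.

Lemma nth_genfib_seq (C : comNzRingType) (k n j : nat) :
  (genfib_seq C k n)`_j = genfib C k (n%:Z - j%:Z).
Proof.
elim: n j => [|n IHn] [|j]; rewrite ?subr0 //.
have -> : (n.+1%:Z - j.+1%:Z = n%:Z - j%:Z) by rewrite !intS opprD addrACA subrr add0r.
by rewrite -IHn; case: n {IHn} => [|n] //=; rewrite nth_nil.
Qed.

Lemma genfibS (C : comNzRingType) (k : nat) (n : int) : 1 <= n ->
  genfib C k (n + 1) =
  \sum_(1 <= j < k.+1) gvar C k j * genfib C k (n + 1 - j%:Z).
Proof.
case: n => // -[//|n] _; rewrite big_add1 /= big_mkord -PoszD addn1.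
change (genfib C k n.+2)
  with (\sum_(j < k) gvar C k j.+1 * (genfib_seq C k n.+1)`_j).
apply: eq_bigr => j _; rewrite nth_genfib_seq; congr (_ * genfib C k _).
by rewrite addnS addn0 [in RHS]intS [in RHS](intS j) opprD addrACA subrr add0r.
Qed.

Notation ratfun C k := {fraction {mpoly C[k]}}.

(* Rows and columns are numbered from 0, which does not change d = r - s.
   The exponent d is an integer, so that the case d = -1 reads 'i * t_2; the
   guard gives d + 1 >= 0, so [absz (d + 1)] is just d + 1. *)
Definition Qmx (C : numClosedFieldType) (k n : nat) : 'M[ratfun C k]_n :=
  let t (j : nat) : ratfun C k := tofrac (gvar C k j) in
  let I : ratfun C k := tofrac (('i : C)%:MP) in
  \matrix_(r, s)
    let d : int := (r : nat)%:Z - (s : nat)%:Z in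
    if (-1 <= d) && (d < k%:Z)
    then I ^+ (absz d) * (t (absz (d + 1)) / t 2%N ^ d)
    else 0.

(* Main.v *)
Require Import Defs.
From mathcomp Require Import all_boot all_order all_algebra.
From mathcomp Require Import fraction mpoly complex reals.
From mathcomp Require Import zify.

Set Implicit Arguments.
Unset Strict Implicit.
Unset Printing Implicit Defensive.

Import Order.TTheory GRing.Theory Num.Theory.
Local Open Scope ring_scope.

(* A Toeplitz-Hessenberg matrix with superdiagonal entry c_0 has determinant D_n,
   where D_(n+1) = \sum_j (-c_0)^j c_(j+1) D_(n-j): the combination of its n+1 rows
   with coefficients (-c_0)^r D_(n-r) is (D_(n+1), 0, ..., 0), and once the last row
   is replaced by it, deleting that row and the first column leaves a triangular
   matrix with diagonal c_0.  For Q_{k,n} the factors i and t_2 cancel in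
   (-c_0)^j c_(j+1) = t_(j+1), so this is the recurrence of F_{k,n+1}. *)

Lemma det_toeplitz_hessenberg (F : idomainType) (c D : nat -> F) :
    c 0%N != 0 -> D 0%N = 1 ->
    (forall n, D n.+1 = \sum_(j < n.+1) (- c 0%N) ^+ j * c j.+1 * D (n - j)%N) ->
  forall n, \det (\matrix_(r < n, s < n)
    if (s <= r.+1)%N then c (r.+1 - s)%N else 0) = D n.
Proof.
move=> c0 D0 DS [|m]; first by rewrite det_mx00.
set Q := \matrix_(r, s) _.
(* Left multiplication by [W] replaces the last row by the combination. [W] is lower triangular,
   with last diagonal entry [(- c 0) ^+ m] since [D 0 = 1]. *)
pose W : 'M[F]_m.+1 := \matrix_(r, s)
  if r == ord_max then (- c 0%N) ^+ s * D (m - s)%N else (r == s)%:R.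
have detW : \det W = (- c 0%N) ^+ m.
  rewrite det_trig.
    rewrite big_ord_recr big1 /= => [|i _]; rewrite !mxE.
      by rewrite eqxx subnn D0 mulr1 mul1r.
    by rewrite eqxx -val_eqE /= ltn_eqF.
  apply/is_trig_mxP => r s rs; rewrite mxE -!val_eqE /= (ltn_eqF rs).
  by rewrite ltn_eqF // (leq_trans rs) // -ltnS.
have WQ r s : r != ord_max -> (W *m Q) r s = Q r s.
  move=> rm; rewrite mxE (bigD1 r) //= [W _ _]mxE (negPf rm) eqxx mul1r.
  by rewrite big1 ?addr0 // => j jr; rewrite mxE (negPf rm) eq_sym (negPf jr) mul0r.
(* With [r = s + j], this is the recurrence for [D (m.+1 - s)] multiplied by [(- c 0) ^+ s]. *)
have tail s : (s <= m)%N -> \sum_(s <= r < m.+1)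
    (- c 0%N) ^+ r * D (m - r)%N * c (r.+1 - s)%N = (- c 0%N) ^+ s * D (m.+1 - s)%N.
  move=> sm; rewrite -{1}[s]add0n big_addn big_mkord subSn // DS mulr_sumr.
  apply: eq_bigr => j _; rewrite exprD -addSn addnK addnC subnDA.
  by rewrite -!mulrA [D _ * _]mulrC mulrCA.
have lastWQ s : (W *m Q) ord_max s = (s == ord0)%:R * D m.+1.
  rewrite mxE; under eq_bigr => j _ do rewrite [W _ _]mxE eqxx [Q _ _]mxE.
  rewrite -(big_mkord xpredT (fun j => (- c 0%N) ^+ j * D (m - j)%N *
    (if (s <= j.+1)%N then c (j.+1 - s)%N else 0))).
  case: s => -[|s] /= lt_s.
    by rewrite tail // subn0 expr0.
  (* In column [s.+1], the rows before [s] contribute 0, row [s] gives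
     [(- c 0) ^+ s * D (m - s) * c 0], and by [tail] the later rows sum to its opposite. *)
  rewrite (big_cat_nat (n := s)) //=; last by rewrite ltnW // ltnW.
  rewrite big1_seq => [|j]; last first.
    by rewrite mem_index_iota /= => js; rewrite ltnNge js mulr0.
  rewrite add0r (big_ltn (ltnW lt_s)) leqnn subnn mul0r.
  rewrite (eq_big_nat _ _ (F2 := fun r =>
    (- c 0%N) ^+ r * D (m - r)%N * c (r.+1 - s.+1)%N)); last first.
    by move=> j /andP[sj _]; rewrite (leq_trans sj).
  rewrite tail // subSS exprSr mulrN mulNr mulrAC; exact: subrr.
have : \det (W *m Q) = D m.+1 * (- c 0%N) ^+ m.
  rewrite (expand_det_row _ ord_max) big_ord_recl lastWQ eqxx mul1r big1 => [|i _].
    (* The cofactor sign [(-1) ^+ m] and the minor [c 0 ^+ m] combine to [(- c 0) ^+ m], which is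
       [\det W] and cancels at the end. *)
    rewrite addr0 /cofactor addn0; congr (_ * _).
    have minor r t : row' ord_max (col' ord0 (W *m Q)) r t =
        if (t <= r)%N then c (r - t)%N else 0.
      by rewrite 2![LHS]mxE WQ 1?eq_sym ?neq_lift // mxE lift0 lift_max ltnS subSS.
    rewrite det_trig => [|]; last first.
      by apply/is_trig_mxP => r t rt; rewrite minor leqNgt rt.
    under eq_bigr => r _ do rewrite minor leqnn subnn.
    by rewrite prodr_const card_ord -exprMn mulN1r.
  by rewrite lastWQ mul0r mul0r.
rewrite det_mulmx detW mulrC => /mulIf; apply.
by rewrite expf_neq0 // oppr_eq0.
Qed.

Lemma det_toeplitz_hessenberg_scaled (F : fieldType) (k : nat) (x : F) (t D : nat -> F) :
    x * x = -1 -> t 0%N = 1 -> t 2%N != 0 -> (forall j, (k < j)%N -> t j = 0) ->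
    D 0%N = 1 -> (forall n, D n.+1 = \sum_(j < n.+1) t j.+1 * D (n - j)%N) ->
  forall n, \det (\matrix_(r < n, s < n)
    let d : int := (r : nat)%:Z - (s : nat)%:Z in
    if (-1 <= d) && (d < k%:Z)
    then x ^+ absz d * (t (absz (d + 1)) / t 2%N ^ d) else 0) = D n.
Proof.
move=> x2 t0 t2 tk D0 DS n.
have x0 : x != 0.
  by apply/eqP => x0; move/eqP: x2; rewrite x0 mul0r eq_sym oppr_eq0 oner_eq0.
(* [c j] is the entry on the diagonal [d = j - 1]. At [j = 0] the absolute value yields [x] rather
   than its inverse, so the powers of [x] in [cE] combine to [(- x * x) ^+ j = 1]. *)
pose c j := if (j <= k)%N then
  x ^+ absz (j%:Z - 1) * (t j / t 2%N ^ (j%:Z - 1)) else 0.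
have c0E : c 0%N = x * t 2%N by rewrite /c /= t0 mul1r invrK.
have cE j : (- c 0%N) ^+ j * c j.+1 = t j.+1.
  rewrite c0E /c; have [jk|kj] := leqP j.+1 k; last by rewrite mulr0 tk.
  rewrite intS addrAC subrr add0r absz_nat -exprnP -mulNr exprMn.
  rewrite mulrACA [_ * (_ / _)]mulrCA divff ?expf_neq0 // mulr1.
  by rewrite -exprMn mulNr x2 opprK expr1n mul1r.
rewrite -(@det_toeplitz_hessenberg _ c D) //; first last.
- by move=> m; rewrite DS; apply: eq_bigr => j _; rewrite cE.
- by rewrite c0E mulf_neq0.
congr (\det _); apply/matrixP => r s; rewrite !mxE /=.
have [sr|rs] := leqP s r.+1; last by rewrite ifF //; lia.
rewrite /c; have ->: (r.+1 - s)%N%:Z - 1 = r%:Z - s%:Z by lia.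
have ->: absz (r%:Z - s%:Z + 1) = (r.+1 - s)%N by lia.
by congr (if _ then _ else _); lia.
Qed.

(** The [k]-term recurrence and this sum of [n.+1] terms are both padded to [k + n.+1] terms: the
    extra ones vanish because F_m = 0 for m < 1, respectively because [gvar] is 0 beyond index
    [k]. *)
Lemma genfib_rec_ord (C : comNzRingType) (k n : nat) :
  genfib C k n.+2 = \sum_(j < n.+1) gvar C k j.+1 * genfib C k (n - j).+1.
Proof.
rewrite -[LHS]/(\sum_(j < k) gvar C k j.+1 * (genfib_seq C k n.+1)`_j).
rewrite (big_ord_widen (k + n.+1) (fun j => gvar C k j.+1 * (genfib_seq C k n.+1)`_j));
  last exact: leq_addr.
rewrite (big_ord_widen (k + n.+1) (fun j => gvar C k j.+1 * genfib C k (n - j).+1));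
  last exact: leq_addl.
rewrite big_mkcond [RHS]big_mkcond; apply: eq_bigr => j _.
have [jk|kj] := ltnP j k; have [jn|nj] := ltnP j n.+1 => //.
- by rewrite nth_genfib_seq -subSn // subzn // ltnW.
- by rewrite nth_genfib_seq genfib_le0 ?mulr0 //; lia.
- by rewrite /gvar insubF ?mul0r // ltnNge kj.
Qed.

Lemma gvar_neq0 (C : idomainType) (k j : nat) : (j < k)%N -> gvar C k j.+1 != 0.
Proof. by move=> jk; rewrite /gvar insubT /= -msize_poly_eq0 msizeX. Qed.

Theorem theorem2p2 (R : realType) (k n : nat) (hk : (2 <= k)%N) (hn : (1 <= n)%N) :
  \det (Qmx R[i] k n) = tofrac (genfib R[i] k (n%:Z + 1)).
Proof.
rewrite addrC -intS /Qmx.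
apply: (@det_toeplitz_hessenberg_scaled (ratfun R[i] k) k _
  (fun j => tofrac (gvar R[i] k j)) (fun m => tofrac (genfib R[i] k m.+1))).
- by rewrite -tofracM -mpolyCM -expr2 sqrCi mpolyCN tofracN tofrac1.
- by rewrite tofrac1.
(* As [k >= 2], t_2 is a true indeterminate, not the junk value 0. *)
- by rewrite tofrac_eq0 gvar_neq0.
- by case=> // j kj; rewrite /gvar insubF ?tofrac0 // ltnNge -ltnS kj.
- by rewrite genfib1 tofrac1.
move=> m; rewrite genfib_rec_ord rmorph_sum; apply: eq_bigr => j _.
by rewrite rmorphM.
Qed.
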